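(* For integers $p',q',r'$ let $\min(p',q',r';|E|)$ denote the minimum of $|E(G)|$ over all connected finite simple graphs $G$ with $\mathrm{ind\text{-}match}(G)=p'$, $\mathrm{min\text{-}match}(G)=q'$ and $\mathrm{match}(G)=r'$. Let $p,q,r$ be integers with $2\le p<q\le r\le 2q$. Then: (1) $\min(p,q,q;|E|)\le (a_1^2+1)p+(2a_1+1)b_1$, where $a_1,b_1$ are the non-negative integers with $q=a_1p+b_1$ and $0\le b_1\le p-1$; (2) if $q<r\le 2q-p+1$, then $\min(p,q,r;|E|)\le a_2^2(p-1)+(2a_2+1)b_2+p+\binom{2(r-q)+1}{2}$, where $a_2,b_2$ are the non-negative integers with $2q-r=a_2(p-1)+b_2$ and $0\le b_2\le p-2$; (3) if $2q-p+1<r\le 2q$, then $\min(p,q,r;|E|)\le p+2q-r+(p-2q+r)\binom{2a_3+1}{2}+b_3(4a_3+3)$, where $a_3,b_3$ are the non-negative integers with $r-q=a_3(p-2q+r)+b_3$ and $0\le b_3\le p-2q+r-1$.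
   Context: All graphs are finite and simple. A matching of $G$ is a set of pairwise disjoint edges. A maximal matching is a matching not properly contained in another matching. An induced matching is a matching $M$ such that for distinct $e,f\in M$ there is no edge $g$ of $G$ meeting both $e$ and $f$. $\mathrm{match}(G)$ is the maximum size of a matching, $\mathrm{min\text{-}match}(G)$ the minimum size of a maximal matching, and $\mathrm{ind\text{-}match}(G)$ the maximum size of an induced matching of $G$. *)

(* Defs.v *)
From mathcomp Require Import all_boot.

Set Implicit Arguments.
Unset Strict Implicit.
Unset Printing Implicit Defensive.

Record sgraph := SGraph {
  vertex :> finType;
  adj : rel vertex;
  adj_sym : symmetric adj;
  adj_irrefl : irreflexive adj
}.

Section Matchings.
Variable G : sgraph.
Implicit Types (M : {set {set G}}) (e f g : {set G}).

Definition edges : {set {set G}} :=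
  [set f | [exists x, exists y, adj x y && (f == [set x; y])]].

Definition connected : Prop := forall x y : G, connect (@adj G) x y.

Definition matching M : bool := (M \subset edges) && trivIset M.

(* Maximal for inclusion, not of maximum cardinality. *)
Definition maximal_matching M : bool := maxset matching M.

Definition induced_matching M : bool :=
  matching M &&
  [forall e in M, forall f in M, (e != f) ==>
     ~~ [exists g in edges, ~~ [disjoint g & e] && ~~ [disjoint g & f]]].

Definition match_num : nat := \max_(M | matching M) #|M|.

(* The default value #|edges| is harmless: every matching has at most #|edges|
   elements and a maximal matching always exists; see min_matchP. *)
Definition min_match : nat :=
  \big[minn/#|edges|]_(M | maximal_matching M) #|M|.

Definition ind_match : nat := \max_(M | induced_matching M) #|M|.

Lemma maximal_matching_exists : exists M, maximal_matching M.
Proof.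
have m0 : matching set0.
  by rewrite /matching sub0set; apply/trivIsetP => A B; rewrite inE.
by have [M maxM _] := maxset_exists m0; exists M.
Qed.

Lemma min_matchP :
  (exists2 M, maximal_matching M & #|M| = min_match) /\
  (forall M, maximal_matching M -> min_match <= #|M|).
Proof.
have lb M : maximal_matching M -> min_match <= #|M|.
  move=> maxM; rewrite /min_match.
  have: M \in index_enum {set {set G}} by rewrite mem_index_enum.
  elim: (index_enum _) => [|N s IHs] //; rewrite inE big_cons.
  case/predU1P => [<-|/IHs le_s]; first by rewrite maxM geq_minl.
  by case: ifP => // _; apply: leq_trans le_s; apply: geq_minr.
split=> //.
have : min_match = #|edges| \/ exists2 M, maximal_matching M & #|M| = min_match.
  rewrite /min_match.
  elim/big_ind: _ => [|x y Hx Hy|M maxM]; [by left | | by right; exists M].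
  by rewrite /minn; case: ifP.
case=> // eqE; have [M maxM] := maximal_matching_exists.
exists M => //; apply/eqP; rewrite eqn_leq lb // andbT eqE.
by apply: subset_leq_card; case/maxsetP: maxM => /andP[].
Qed.

End Matchings.

Definition realizes (p q r : nat) (G : sgraph) : Prop :=
  [/\ connected G, ind_match G = p, min_match G = q & match_num G = r].

(* [is_min_edges p q r m] reads: min(p, q, r; |E|) exists and equals m. *)
Definition is_min_edges (p q r m : nat) : Prop :=
  (exists2 G : sgraph, realizes p q r G & #|edges G| = m) /\
  (forall G : sgraph, realizes p q r G -> m <= #|edges G|).

(* The minimum is over a nonempty family, so that it exists, and is at most N. *)
Definition min_edges_le (p q r N : nat) : Prop :=
  exists2 m, is_min_edges p q r m & m <= N.

(* Main.v *)
(* Two kinds of graphs have induced matching number 1 and minimal maximal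
   matching number n: the balanced bipartite graph K_{n,n}, with matching number
   n, and the complete graph K_{2n} with a pendant vertex attached to each of its
   vertices, with matching number 2n.  Joining a new hub vertex to one vertex of
   each member of a family of such graphs makes all three invariants add up at
   the cost of one edge per member.  The three bounds count the edges of families
   of p members: (1) only bipartite ones, with sizes as equal as possible; (2) one
   pendant clique, with n = r - q, and p - 1 bipartite ones; (3) 2q - r single
   edges K_{1,1} and p - 2q + r pendant cliques with sizes as equal as possible. *)
Require Import Defs.
From mathcomp Require Import all_boot zify.
From Stdlib Require Import Classical.

Set Implicit Arguments.
Unset Strict Implicit.
Unset Printing Implicit Defensive.

(** * Counting lemmas and existence of the minimum *)

Lemma leq_card_bigcup (I T : finType) (P : pred I) (F : I -> {set T}) :
  #|\bigcup_(i | P i) F i| <= \sum_(i | P i) #|F i|.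
Proof.
apply: (big_ind2 (fun (U : {set T}) m => #|U| <= m)) => [|U m U' m' leU leU'|//].
  by rewrite cards0.
by apply: leq_trans (leq_card_setU U U') _; apply: leq_add.
Qed.

Lemma card_fibers (I T : finType) (h : T -> I) :
  \sum_i #|[set x | h x == i]| = #|T|.
Proof.
rewrite -sum1_card (partition_big h predT) //=.
by apply: eq_bigr => i _; rewrite sum1dep_card.
Qed.

(** Descent on the number of edges: either a realizing graph with fewer edges exists, or [G] attains
    the minimum. Excluded middle decides which, as the search ranges over all graphs. *)
Lemma min_edges_le_realizes (p q r N : nat) (G : sgraph) :
  realizes p q r G -> #|edges G| <= N -> min_edges_le p q r N.
Proof.
move=> rG; have [m] := ubnP #|edges G|; elim: m G rG => // m IHm G rG leGm leGN.
have [[H [rH ltHG]]|noH] :=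
  classic (exists H : sgraph, realizes p q r H /\ #|edges H| < #|edges G|).
  by apply: (IHm H) => //; lia.
exists #|edges G| => //; split; first by exists G.
by move=> H rH; rewrite leqNgt; apply/negP => ltHG; apply: noH; exists H.
Qed.

(** * Matchings in an arbitrary graph *)

Section Matchings.
Variable G : sgraph.
Implicit Types (M : {set {set G}}) (e f : {set G}).

Lemma edgesP e :
  reflect (exists x y, adj x y /\ e = [set x; y]) (e \in edges G).
Proof.
rewrite inE; apply: (iffP existsP) => [[x /existsP[y /andP[xy /eqP->]]]|].
  by exists x, y.
by case=> x [y [xy ->]]; exists x; apply/existsP; exists y; rewrite xy eqxx.
Qed.

Lemma mem_edges (x y : G) : adj x y -> [set x; y] \in edges G.
Proof. by move=> xy; apply/edgesP; exists x, y. Qed.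

Lemma card_edge e : e \in edges G -> #|e| = 2.
Proof.
case/edgesP=> x [y [xy ->]]; rewrite cards2.
by case: eqP xy => // ->; rewrite adj_irrefl.
Qed.

Lemma matching_sub M e : matching M -> e \in M -> e \in edges G.
Proof. by case/andP=> /subsetP sM _ /sM. Qed.

Lemma matching_card M : matching M -> #|M| * 2 = #|cover M|.
Proof.
case/andP=> /subsetP sM /eqP <-; rewrite -sum_nat_const.
by apply: eq_bigr => e /sM/card_edge.
Qed.

Lemma match_num_leq : match_num G <= #|G|./2.
Proof.
apply/bigmax_leqP => M /matching_card eM.
have := max_card (mem (cover M)); rewrite -eM; lia.
Qed.

(** An edge with both ends uncovered could be added to [M]. *)
Lemma maximal_matching_cover M (x y : G) :
  maximal_matching M -> adj x y -> (x \in cover M) || (y \in cover M).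
Proof.
case/maxsetP=> mM maxM xy; apply/negPn/negP; rewrite negb_or => /andP[xM yM].
have dM e : e \in M -> [disjoint [set x; y] & e].
  move=> eM; rewrite -setI_eq0; apply/eqP/setP=> v; rewrite !inE.
  apply/negP => /andP[/orP[]/eqP-> ve];
    [case/negP: xM|case/negP: yM]; apply/bigcupP; by exists e.
have mM' : matching ([set x; y] |: M).
  case/andP: mM => sM tM; rewrite /matching subUset sub1set mem_edges //= sM /=.
  apply/trivIsetP => e f; rewrite !inE.
  case/predU1P=> [->|eM]; case/predU1P=> [->|fM]; rewrite ?eqxx //.
  - by move=> _; apply: dM.
  - by move=> _; rewrite disjoint_sym; apply: dM.
  - by move/trivIsetP: tM; apply.
have eM := maxM _ mM' (subsetUr _ _); case/negP: xM.
by apply/bigcupP; exists [set x; y]; [rewrite -eM setU11 | rewrite !inE eqxx].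
Qed.

(** In a larger matching [N], each edge has an end covered by [M]; disjointness inside [N] then
    identifies it with the edge of [M] at that end. *)
Lemma cover_maximal_matching M : matching M ->
  (forall x y : G, adj x y -> (x \in cover M) || (y \in cover M)) ->
  maximal_matching M.
Proof.
move=> mM cM; apply/maxsetP; split=> // N /andP[/subsetP sN tN] sMN.
apply/eqP; rewrite eqEsubset sMN andbT; apply/subsetP => e eN.
have /edgesP[x [y [xy De]]] := sN e eN.
have meet v : v \in e -> v \in cover M -> e \in M.
  move=> ve /bigcupP[f fM vf]; have [->//|nef] := eqVneq e f.
  have /disjointFr -/(_ v ve) : [disjoint e & f].
    by move/trivIsetP: tN; apply=> //; apply: (subsetP sMN).
  by rewrite vf.
by case/orP: (cM x y xy); apply: meet; rewrite De !inE eqxx ?orbT.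
Qed.

(** Stating disjointness vertex by vertex yields the injectivity of [E] as well, since edges are
    nonempty. All explicit matchings below are built this way. *)
Lemma family_matching (J : finType) (E : J -> {set G}) :
  (forall j, E j \in edges G) ->
  (forall i j v, v \in E i -> v \in E j -> i = j) ->
  matching (E @: J) /\ #|E @: J| = #|J|.
Proof.
move=> edE disE; split.
  apply/andP; split; first by apply/subsetP=> _ /imsetP[j _ ->].
  apply/trivIsetP => _ _ /imsetP[i _ ->] /imsetP[j _ ->] neE.
  rewrite -setI_eq0; apply/eqP/setP=> v; rewrite !inE; apply/negP.
  by case/andP=> vi vj; case/eqP: neE; rewrite (disE i j v).
apply: card_imset => i j eqE.
have /edgesP[x [y [_ De]]] := edE i.
by apply: (disE i j x); rewrite -?eqE De !inE eqxx.
Qed.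

(** The edges of [M] that meet [D] cover it, each accounting for at most [k] vertices. *)
Lemma matching_card_meet M (D : {set G}) k : matching M -> D \subset cover M ->
  (forall e, e \in M -> #|e :&: D| <= k) ->
  #|D| <= #|[set e in M | ~~ [disjoint e & D]]| * k.
Proof.
move=> mM sDM leD; rewrite -sum_nat_const.
apply: (@leq_trans (\sum_(e in [set e in M | ~~ [disjoint e & D]]) #|e :&: D|)).
  apply: leq_trans (leq_card_bigcup _ _); apply: subset_leq_card.
  apply/subsetP => v vD; have /bigcupP[e eM ve] := subsetP sDM v vD.
  apply/bigcupP; exists e; rewrite !inE ?ve ?vD // eM.
  by apply/pred0Pn; exists v; rewrite /= ve.
by apply: leq_sum => e; rewrite inE => /andP[/leD].
Qed.

(** [R] sorts edges into classes indexed by [I]. Two edges of one class are linked by an edge, so an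
    induced matching has at most one edge per class. *)
Lemma ind_match_leq (I : finType) (R : {set G} -> I -> bool) :
  (forall e, e \in edges G -> exists i, R e i) ->
  (forall e f i, e \in edges G -> f \in edges G -> R e i -> R f i ->
     exists2 g, g \in edges G & ~~ [disjoint g & e] && ~~ [disjoint g & f]) ->
  ind_match G <= #|I|.
Proof.
move=> exR linkR; apply/bigmax_leqP => M /andP[mM indM].
have [->|[e0 e0M]] := set_0Vmem M; first by rewrite cards0.
(* A default index for [odflt]; this is why empty [M] is treated first. *)
have [i0 _] := exR _ (matching_sub mM e0M).
pose h e := odflt i0 [pick i | R e i].
have hP e : e \in M -> R e (h e).
  move=> /(matching_sub mM)/exR[i Ri]; rewrite /h.
  by case: pickP => //= /(_ i); rewrite Ri.
rewrite -(@card_in_imset _ _ h) ?max_card // => e f eM fM eqh.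
have [//|nef] := eqVneq e f.
have [||||g gE gef] := linkR e f (h e); rewrite ?(matching_sub mM) ?hP ?eqh ?hP //.
move/forall_inP: indM => /(_ e eM)/forall_inP/(_ f fM); rewrite nef /=.
by case/existsP; exists g; rewrite gE.
Qed.

End Matchings.

(** * The joined graph and its members *)

Section JoinedGraph.
Variables (A B Q W : finType) (c : Q -> A) (d : W -> B).
Variables (ra : A -> Q) (rb : B -> W).
Hypotheses (raK : cancel ra c) (rbK : cancel rb d).

(* A and B index the bipartite and the pendant-clique members; c and d give the
   member of an index.  The members are K_{n,n} on Q * bool with n the size of the
   fibre of c, and the clique on W * bool of 2n vertices with its pendants. The
   boolean s is false for the side (resp. the clique) attached to the hub. *)
Definition jvertex : finType := option (Q * bool + (W * bool) * bool).

Definition hub : jvertex := None.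
Definition bip (y : Q) s : jvertex := Some (inl (y, s)).
Definition whk (x : W * bool) s : jvertex := Some (inr (x, s)).

(** The hub is joined to [ra a] and [rb b], one vertex of each member. Between [inr] vertices, equal
    flags give clique edges (both [false]) and different flags give pendant edges. *)
Definition jadj (u v : jvertex) : bool :=
  match u, v with
  | None, Some (inl (y, s)) | Some (inl (y, s)), None => ~~ s && (y == ra (c y))
  | None, Some (inr (x, s)) | Some (inr (x, s)), None =>
      ~~ s && (x == (rb (d x.1), false))
  | Some (inl (y, s)), Some (inl (y', s')) => (c y == c y') && (s != s')
  | Some (inr (x, s)), Some (inr (x', s')) =>
      (d x.1 == d x'.1) && (if s == s' then ~~ s && (x != x') else x == x')
  | _, _ => false
  end.

Lemma jadj_sym : symmetric jadj.
Proof.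
case=> [[[y s]|[x s]]|] [[[y' s']|[x' s']]|] //=.
  by rewrite eq_sym [s == _]eq_sym.
rewrite [d x'.1 == _]eq_sym [s' == s]eq_sym [x' == x]eq_sym.
by case: (s =P s') => // ->.
Qed.

Lemma jadj_irrefl : irreflexive jadj.
Proof. by case=> [[[y s]|[x s]]|] //=; rewrite !eqxx ?andbF. Qed.

Definition jgraph := SGraph jadj_sym jadj_irrefl.

(** The component after deletion of the hub, which itself gets [None]. *)
Definition comp (u : jvertex) : option (A + B) :=
  match u with
  | Some (inl (y, _)) => Some (inl (c y))
  | Some (inr (x, _)) => Some (inr (d x.1))
  | None => None
  end.

Lemma adj_comp u v i j :
  jadj u v -> comp u = Some i -> comp v = Some j -> i = j.
Proof.
case: u => [[[y s]|[x s]]|] //; case: v => [[[y' s']|[x' s']]|] //=.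
  by case/andP=> /eqP-> _ [<-] [<-].
by case/andP=> /eqP-> _ [<-] [<-].
Qed.

(** An edge through the hub has only one other end, so every edge meets at most one member. Hence
    counts over members can be added. *)
Lemma edge_comp (e : {set jgraph}) u v i j : e \in edges jgraph ->
  u \in e -> v \in e -> comp u = Some i -> comp v = Some j -> i = j.
Proof.
case/edgesP=> x [y [xy ->]]; rewrite !inE.
case/orP=> /eqP->; case/orP=> /eqP-> ci cj.
- by move: cj; rewrite ci => -[].
- exact: adj_comp xy ci cj.
- by rewrite (adj_comp xy cj ci).
- by move: cj; rewrite ci => -[].
Qed.

Definition meets (e : {set jgraph}) i := [exists v in e, comp v == Some i].

(** * Connectedness and matching number *)

Lemma jgraph_connected : connected jgraph.
Proof.
have symC : connect_sym (@adj jgraph) by apply: sym_connect_sym; apply: adj_sym.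
suff toH w : connect (@adj jgraph) w hub.
  by move=> u v; apply: connect_trans (toH u) _; rewrite symC.
have link u v : connect (@adj jgraph) v hub -> jadj u v ->
    connect (@adj jgraph) u hub.
  by move=> vh uv; apply: connect_trans vh; apply: connect1.
have rootA a : connect (@adj jgraph) (bip (ra a) false) hub.
  by apply: connect1; rewrite /= raK eqxx.
have rootB b : connect (@adj jgraph) (whk (rb b, false) false) hub.
  by apply: connect1; rewrite /= rbK eqxx.
case: w => [[[y s]|[x s]]|]; last exact: connect0.
  have trueA : connect (@adj jgraph) (bip y true) hub.
    by apply: link (rootA (c y)) _; rewrite /= raK eqxx.
  case: s => //; apply: (link _ (bip (ra (c y)) true)); last first.
    by rewrite /= raK eqxx.
  by apply: link (rootA (c y)) _; rewrite /= eqxx.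
have falseB : connect (@adj jgraph) (whk x false) hub.
  have [->|nx] := eqVneq x (rb (d x.1), false); first exact: rootB.
  by apply: link (rootB (d x.1)) _; rewrite /= rbK eqxx.
by case: s => //; apply: link falseB _; rewrite /= !eqxx.
Qed.

(** There are [1 + 2 * #|Q| + 4 * #|W|] vertices, and some matching misses only the hub. *)
Lemma jgraph_match : match_num jgraph = #|Q| + 2 * #|W|.
Proof.
apply/eqP; rewrite eqn_leq; apply/andP; split.
  apply: leq_trans (match_num_leq _) _.
  by rewrite card_option card_sum !card_prod !card_bool; lia.
pose E (j : Q + W * bool) : {set jgraph} := match j with
  | inl y => [set bip y false; bip y true]
  | inr x => [set whk x false; whk x true] end.
have [||mE cE] := @family_matching jgraph _ E.
- by case=> [y|x]; apply: mem_edges; rewrite /= !eqxx.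
- case=> [y|x] [y'|x'] v; rewrite !inE;
  by case/orP=> /eqP->; case/orP=> // /eqP[->].
rewrite -[X in X <= _](_ : #|E @: predT| = _); first exact: leq_bigmax_cond.
by rewrite cE card_sum card_prod card_bool mulnC.
Qed.

(** * Induced matching number *)

Lemma edge_meets e : e \in edges jgraph -> exists i, meets e i.
Proof.
case/edgesP=> u [v [uv ->]].
have [i ci|nu] := pickP (fun i => (comp u == Some i) || (comp v == Some i)).
  by exists i; case/orP: ci => ci; apply/existsP;
    [exists u|exists v]; rewrite !inE eqxx ?orbT.
case: u uv nu => [[[y s]|[x s]]|].
- by move=> _ /(_ (inl (c y))); rewrite /= eqxx.
- by move=> _ /(_ (inr (d x.1))); rewrite /= eqxx.
case: v => [[[y s]|[x s]]|] //.
- by move=> _ /(_ (inl (c y))); rewrite /= eqxx.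
- by move=> _ /(_ (inr (d x.1))); rewrite /= eqxx.
Qed.

(** Two edges meeting the same bipartite member are therefore linked: either both contain the hub,
    or the [false] end of one is adjacent to the [true] end of the other. *)
Lemma edge_meetsA e a : e \in edges jgraph -> meets e (inl a) ->
  (exists2 y, c y = a & bip y false \in e) /\
  (hub \in e \/ exists2 y, c y = a & bip y true \in e).
Proof.
case/edgesP=> u [v [uv ->]] /existsP[w].
rewrite !inE => /andP[/orP[]/eqP->]; case: u uv => [[[y s]|[x s]]|] //;
  case: v => [[[y' s']|[x' s']]|] //=.
- case/andP=> /eqP cy; case: s s' => [] [] // _ /eqP[<-]; split.
  + by exists y' => //; rewrite !inE eqxx orbT.
  + by right; exists y => //; rewrite !inE eqxx.
  + by exists y => //; rewrite !inE eqxx.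
  + by right; exists y' => //; rewrite !inE eqxx orbT.
- case: s => // _ /eqP[<-]; split; last by left.
  by exists y => //; rewrite !inE eqxx.
- case/andP=> /eqP cy; case: s s' => [] [] // _ /eqP[<-]; split.
  + by exists y' => //; rewrite !inE eqxx orbT.
  + by right; exists y => //; rewrite !inE eqxx.
  + by exists y => //; rewrite !inE eqxx.
  + by right; exists y' => //; rewrite !inE eqxx orbT.
- case: s' => // _ /eqP[<-]; split; last by left.
  by exists y' => //; rewrite !inE eqxx orbT.
Qed.

(** Neither the pendants nor the hub can supply both ends. Clique vertices being equal or adjacent,
    two edges meeting the same clique member are linked. *)
Lemma edge_meetsB e b : e \in edges jgraph -> meets e (inr b) ->
  exists2 x, d x.1 = b & whk x false \in e.
Proof.
case/edgesP=> u [v [uv ->]] /existsP[w].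
rewrite !inE => /andP[/orP[]/eqP->]; case: u uv => [[[y s]|[x s]]|] //;
  case: v => [[[y' s']|[x' s']]|] //=.
- case/andP=> /eqP dx; case: s s' => [] [] //= _ /eqP[<-];
   by [exists x; rewrite ?inE ?eqxx | exists x'; rewrite ?inE ?eqxx ?orbT].
- by case: s => // _ /eqP[<-]; exists x; rewrite ?inE ?eqxx.
- case/andP=> /eqP dx; case: s s' => [] [] //= _ /eqP[<-];
   by [exists x; rewrite ?inE ?eqxx | exists x'; rewrite ?inE ?eqxx ?orbT].
- by case: s' => // _ /eqP[<-]; exists x'; rewrite ?inE ?eqxx ?orbT.
Qed.

Lemma jgraph_ind : ind_match jgraph = #|A| + #|B|.
Proof.
apply/eqP; rewrite eqn_leq; apply/andP; split.
  rewrite -card_sum; apply: (ind_match_leq (R := meets)); first exact: edge_meets.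
  have ndj (g h : {set jgraph}) v : v \in g -> v \in h -> ~~ [disjoint g & h].
    by move=> vg vh; apply/pred0Pn; exists v; rewrite /= vg.
  have link (e f : {set jgraph}) u v : u \in e -> v \in f -> jadj u v ->
    exists2 g, g \in edges jgraph & ~~ [disjoint g & e] && ~~ [disjoint g & f].
    move=> ue vf uv; exists [set u; v]; first exact: mem_edges.
    by rewrite (ndj _ _ u) ?(ndj _ _ v) ?inE ?eqxx ?orbT.
  have self (e f : {set jgraph}) u : e \in edges jgraph -> u \in e -> u \in f ->
    exists2 g, g \in edges jgraph & ~~ [disjoint g & e] && ~~ [disjoint g & f].
    by move=> eE ue uf; exists e; rewrite // !(ndj _ _ u).
  move=> e f [a|b] eE fE eR fR.
    have [[y cy ye] he] := edge_meetsA eE eR.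
    have [[z cz zf] hf] := edge_meetsA fE fR.
    case: hf => [hubf|[z' cz' zf']]; last first.
      by apply: link ye zf' _; rewrite /= cy cz' eqxx.
    case: he => [hube|[y' cy' ye']]; first exact: self hube hubf.
    by apply: link ye' zf _; rewrite /= cy' cz eqxx.
  have [x dx xe] := edge_meetsB eE eR; have [z dz zf] := edge_meetsB fE fR.
  have [eqxz|nexz] := eqVneq x z; first by apply: self xe _ => //; rewrite eqxz.
  by apply: link xe zf _; rewrite /= dx dz eqxx.
(* One edge inside each member; an edge meeting two of these would meet two members. *)
pose E (i : A + B) : {set jgraph} := match i with
  | inl a => [set bip (ra a) false; bip (ra a) true]
  | inr b => [set whk (rb b, false) false; whk (rb b, false) true] end.
have compE i v : v \in E i -> comp v = Some i.
  by case: i => [a|b]; rewrite !inE => /orP[]/eqP-> /=; rewrite ?raK ?rbK.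
have [||mE cE] := @family_matching jgraph _ E.
- by case=> [y|x]; apply: mem_edges; rewrite /= !eqxx.
- by move=> i j v /compE ci /compE; rewrite ci => -[].
rewrite -card_sum -cE; apply: leq_bigmax_cond; rewrite /induced_matching mE /=.
apply/forall_inP=> _ /imsetP[i _ ->]; apply/forall_inP=> _ /imsetP[j _ ->].
apply/implyP=> /eqP neE; apply/existsP=> -[g /and3P[gE]].
case/pred0Pn=> u /andP[/= ug /compE cu] /pred0Pn[v /andP[/= vg /compE cv]].
by case: neE; rewrite (edge_comp gE ug vg cu cv).
Qed.

(** * Minimum size of a maximal matching *)

Lemma jgraph_min_leq : min_match jgraph <= #|Q| + #|W|.
Proof.
(* Cliques are matched within themselves, which leaves uncovered only the pendants and the hub, an
   independent set. *)
pose E (j : Q + W) : {set jgraph} := match j with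
  | inl y => [set bip y false; bip y true]
  | inr w => [set whk (w, false) false; whk (w, true) false] end.
have [||mE cE] := @family_matching jgraph _ E.
- by case=> [y|x]; apply: mem_edges; rewrite /= ?xpair_eqE !eqxx.
- case=> [y|x] [y'|x'] v; rewrite !inE;
  by case/orP=> /eqP->; case/orP=> // /eqP[->].
rewrite -card_sum -cE; have [_] := min_matchP jgraph; apply.
have cA y : bip y false \in cover (E @: predT).
  by apply/bigcupP; exists (E (inl y)); rewrite ?imset_f // !inE eqxx.
have cB x : whk x false \in cover (E @: predT).
  apply/bigcupP; exists (E (inr x.1)); rewrite ?imset_f // !inE.
  by case: x => w [] /=; rewrite eqxx ?orbT.
apply: cover_maximal_matching => // u v.
case: u => [[[y s]|[x s]]|] //; case: v => [[[y' s']|[x' s']]|] //=.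
- by case/andP=> _; case: s s' => [] [] // _; rewrite ?cA ?orbT.
- by case: s => // _; rewrite cA.
- by case/andP=> _; case: s s' => [] [] // _; rewrite ?cB ?orbT.
- by case: s => // _; rewrite cB.
- by case: s' => // _; rewrite cA orbT.
- by case: s' => // _; rewrite cB orbT.
Qed.

Definition fibA a : {set Q} := [set y | c y == a].
Definition fibB b : {set W} := [set w | d w == b].

Lemma leq_meets (M : {set {set jgraph}}) (D : {set jgraph}) i k :
  matching M -> D \subset cover M -> (forall v, v \in D -> comp v = Some i) ->
  (forall e, e \in M -> #|e :&: D| <= k) ->
  #|D| <= #|[set e in M | meets e i]| * k.
Proof.
move=> mM sDM cD leD; apply: leq_trans (matching_card_meet mM sDM leD) _.
rewrite leq_mul2r; apply/orP; right; apply: subset_leq_card.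
apply/subsetP=> e; rewrite !inE => /andP[-> /pred0Pn[v /andP[/= ve vD]]].
by apply/existsP; exists v; rewrite ve cD /=.
Qed.

Lemma maximal_meetsA M a : maximal_matching M ->
  #|fibA a| <= #|[set e in M | @meets e (inl a)]|.
Proof.
move=> maxM; have mM : matching M by case/maxsetP: maxM.
(* Uncovered vertices are pairwise non-adjacent, so one side is covered. *)
have [s cs] : exists s, forall y, c y = a -> bip y s \in cover M.
  have [/existsP[y /andP[/eqP cy ny]]|no] :=
    boolP [exists y, (c y == a) && (bip y false \notin cover M)].
    exists true => z cz; have := @maximal_matching_cover jgraph M (bip y false)
      (bip z true) maxM; rewrite (negPf ny) /=; apply.
    by rewrite cy cz eqxx.
  exists false => y cy; apply/negPn/negP=> ny; case/existsP: no.
  by exists y; rewrite cy eqxx.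
pose D : {set jgraph} := [set bip y s | y in fibA a].
have <- : #|D| = #|fibA a| by apply: card_imset => y y' [].
rewrite -[X in _ <= X]muln1; apply: leq_meets => //.
- by apply/subsetP=> v /imsetP[y]; rewrite inE => /eqP cy ->; apply: cs.
- by move=> v /imsetP[y]; rewrite inE => /eqP <- ->.
(* No edge has both ends on side [s], whence the factor 1. *)
move=> e eM; have /edgesP[u [v [uv De]]] := matching_sub mM eM.
apply/card_le1_eqP=> x x'; rewrite !inE De !inE.
case/andP=> xe /imsetP[y _ Dx]; case/andP=> xe' /imsetP[y' _ Dx'].
have {uv} nuv (w w' : Q) : ~ (u = bip w s /\ v = bip w' s).
  by case=> eu ev; move: uv; rewrite eu ev /= eqxx andbF.
move: xe xe'; case/orP=> /eqP e1; case/orP=> /eqP e2; rewrite ?e1 ?e2 //.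
- by case: (nuv y y'); rewrite -e1 -e2.
- by case: (nuv y' y); rewrite -e1 -e2.
Qed.

Lemma maximal_meetsB M b : maximal_matching M ->
  #|fibB b| <= #|[set e in M | @meets e (inr b)]|.
Proof.
move=> maxM; have mM : matching M by case/maxsetP: maxM.
pose K : {set jgraph} := [set whk x false | x in setX (fibB b) setT].
have cK : #|K| = #|fibB b| * 2.
  rewrite card_imset; last by move=> x x' [].
  by rewrite cardsX cardsT card_bool.
(* Uncovered vertices are pairwise non-adjacent: at most one lies in K. *)
have nK : #|K :\: cover M| <= 1.
  apply/card_le1_eqP=> u v; rewrite !inE.
  case/andP=> nu /imsetP[x]; rewrite !inE andbT => /eqP dx Du.
  case/andP=> nv /imsetP[z]; rewrite !inE andbT => /eqP dz Dv.
  apply/eqP/negPn/negP => neuv.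
  have := @maximal_matching_cover jgraph M u v maxM.
  rewrite (negPf nu) (negPf nv) /= => nuv; suff /nuv : jadj u v by [].
  by rewrite Du Dv /= dx dz eqxx; apply: contraNneq neuv => xz; rewrite Du Dv xz.
have := @leq_meets M (K :&: cover M) (inr b) 2 mM (subsetIr _ _).
rewrite -(cardsID (cover M) K) in cK.
suff H1 : forall v, v \in K :&: cover M -> comp v = Some (inr b).
  suff H2 : forall e, e \in M -> #|e :&: (K :&: cover M)| <= 2.
    move/(_ H1 H2) => le2.
    (* With [n] the fibre size and [m] the number of edges counted, at most [2m] vertices of [K] are
       covered and at most one is not: [2n <= 2m + 1], so [n <= m] by parity. *)
    rewrite -ltnS -(@ltn_pmul2r 2) // -cK mulSn addnC.
    by rewrite -addSn; apply: leq_add.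
  move=> e /(matching_sub mM)/card_edge <-.
  by apply: subset_leq_card; apply: subsetIl.
by move=> v /setIP[/imsetP[x]]; rewrite !inE andbT => /eqP <- -> _.
Qed.

Lemma jgraph_min_geq : #|Q| + #|W| <= min_match jgraph.
Proof.
have [[M maxM <-] _] := min_matchP jgraph.
have mM : matching M by case/maxsetP: maxM.
rewrite -(card_fibers c) -(card_fibers d).
apply: (@leq_trans (\sum_i #|[set e in M | meets e i]|)).
  by rewrite big_sumType; apply: leq_add; apply: leq_sum => i _;
    [apply: maximal_meetsA | apply: maximal_meetsB].
(* Double counting of pairs of an edge of [M] and a member it meets: each edge contributes at most
   1. *)
under eq_bigr => i _ do rewrite -sum1dep_card big_mkcondr.
rewrite exchange_big /= -sum1_card; apply: leq_sum => e eM.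
rewrite -big_mkcond sum1_card; apply/card_le1_eqP=> i j.
case/existsP=> u /andP[ue /eqP cu]; case/existsP=> v /andP[ve /eqP cv].
exact: edge_comp (matching_sub mM eM) ve ue cv cu.
Qed.

(** * Number of edges *)

Lemma jgraph_edges :
  #|edges jgraph| <= #|A| + #|B| + \sum_a #|fibA a| ^ 2
                     + \sum_b 'C(2 * #|fibB b| + 1, 2).
Proof.
(* [Z] holds the hub edges, [EA] the bipartite ones, [EP] the pendant ones and [EK] the clique
   ones. *)
pose Z : {set {set jgraph}} := [set [set hub; bip (ra a) false] | a : A]
  :|: [set [set hub; whk (rb b, false) false] | b : B].
pose EA a : {set {set jgraph}} :=
  [set [set bip p.1 false; bip p.2 true] | p in setX (fibA a) (fibA a)].
pose K b : {set W * bool} := setX (fibB b) setT.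
pose EP b : {set {set jgraph}} := [set [set whk x false; whk x true] | x in K b].
pose EK b : {set {set jgraph}} :=
  [set [set whk x false | x in S : {set W * bool}]
    | S in [set S : {set W * bool} | S \subset K b & #|S| == 2]].
have cK b : #|K b| = 2 * #|fibB b| by rewrite cardsX cardsT card_bool mulnC.
have sub : edges jgraph \subset
    Z :|: \bigcup_a EA a :|: \bigcup_b (EP b :|: EK b).
  apply/subsetP=> e /edgesP[u [v [uv ->]]].
  (* Orient the edge: it starts at the hub, or else at a [false] vertex and avoids the hub. *)
  wlog: u v uv / match u, v with
    | None, _ | Some (inl (_, false)), Some _ | Some (inr (_, false)), Some _ =>
      true | _, _ => false end.
    move=> th; have vu : jadj v u by rewrite jadj_sym.
    have := th u v uv; have := th v u vu; rewrite [ [set v; u] ]setUC.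
    move=> {th vu}; move: uv; case: u => [[[y s]|[x s]]|] //;
      case: v => [[[y' s']|[x' s']]|] //=; try by move=> _ h1 h2; auto.
    + by case: s s' => [] [] //=; rewrite ?andbF //; auto.
    + by case: s s' => [] [] //=; rewrite ?andbF //; auto.
  case: u uv => [[[y [] ]|[x [] ]]|] //; case: v => [[[y' s']|[x' s']]|] //=.
  - case: s'; rewrite ?andbF // andbT => /eqP cy _.
    rewrite !inE; apply/orP; left; apply/orP; right.
    apply/bigcupP; exists (c y) => //; apply/imsetP; exists (y, y') => //.
    by rewrite !inE /= cy eqxx.
  - case/andP=> /eqP dx nx _; rewrite inE; apply/orP; right.
    apply/bigcupP; exists (d x.1) => //; rewrite inE.
    case: s' nx => /= [/eqP <-|nx]; apply/orP; [left|right]; apply/imsetP.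
      by exists x; rewrite ?inE /= ?eqxx.
    exists [set x; x']; last by rewrite imsetU !imset_set1.
    by rewrite inE cards2 nx subUset !sub1set !inE /= dx eqxx.
  - case: s' => //= /eqP Dy _; rewrite !inE; do 3![apply/orP; left].
    by apply/imsetP; exists (c y'); rewrite // -Dy.
  - case: s' => //= /eqP Dx _; rewrite !inE; apply/orP; left.
    apply/orP; left; apply/orP; right.
    by apply/imsetP; exists (d x'.1); rewrite // -Dx.
apply: leq_trans (subset_leq_card sub) _.
apply: leq_trans (leq_card_setU _ _) _; apply: leq_add.
  apply: leq_trans (leq_card_setU _ _) _; apply: leq_add.
    apply: leq_trans (leq_card_setU _ _) _.
    by apply: leq_add; apply: leq_imset_card.
  apply: leq_trans (leq_card_bigcup _ _) _; apply: leq_sum => a _.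
  by apply: leq_trans (leq_imset_card _ _) _; rewrite cardsX mulnn.
apply: leq_trans (leq_card_bigcup _ _) _; apply: leq_sum => b _.
(* Pascal's rule splits the binomial into the pairs in the clique and its [2n] pendant edges, [n]
   being the fibre size. *)
rewrite addn1 binS bin1 -cK -cards_draws setUC.
apply: leq_trans (leq_card_setU _ _) _.
by apply: leq_add; apply: leq_imset_card.
Qed.

Lemma jgraph_realizes :
  realizes (#|A| + #|B|) (#|Q| + #|W|) (#|Q| + 2 * #|W|) jgraph.
Proof.
split; [exact: jgraph_connected | exact: jgraph_ind | | exact: jgraph_match].
by apply/eqP; rewrite eqn_leq jgraph_min_leq jgraph_min_geq.
Qed.

End JoinedGraph.

(** * Prescribed member sizes and the three bounds *)

Lemma card_tag_fiber k (n : 'I_k -> nat) i :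
  #|[set y : {j : 'I_k & 'I_(n j)} | tag y == i]| = n i.
Proof.
transitivity #|[set Tagged (fun j => 'I_(n j)) x | x : 'I_(n i)]|.
  congr #|pred_of_set _|; apply/setP=> -[j x]; rewrite inE /=.
  apply/eqP/imsetP => [eij|[x' _ /(congr1 tag)] //].
  by rewrite -eij; exists x.
by rewrite card_imset ?card_ord //; move=> x y; apply: eq_from_Tagged.
Qed.

(** Tagged sums of ordinals give fibres of the chosen sizes; positivity provides the vertices
    attached to the hub. *)
Lemma min_edges_le_sum k l (n : 'I_k -> nat) (m : 'I_l -> nat) :
  (forall i, 0 < n i) -> (forall j, 0 < m j) ->
  min_edges_le (k + l) (\sum_i n i + \sum_j m j) (\sum_i n i + 2 * \sum_j m j)
    (k + l + \sum_i n i ^ 2 + \sum_j 'C(2 * m j + 1, 2)).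
Proof.
move=> n0 m0.
pose ra i : {i : 'I_k & 'I_(n i)} := Tagged (fun j => 'I_(n j)) (Ordinal (n0 i)).
pose rb j : {j : 'I_l & 'I_(m j)} := Tagged (fun j => 'I_(m j)) (Ordinal (m0 j)).
have raK : cancel ra tag by [].
have rbK : cancel rb tag by [].
have sumA : \sum_i n i = #|{: {i : 'I_k & 'I_(n i)}}|.
  by rewrite -(card_fibers tag); apply: eq_bigr => i _; rewrite card_tag_fiber.
have sumB : \sum_j m j = #|{: {j : 'I_l & 'I_(m j)}}|.
  by rewrite -(card_fibers tag); apply: eq_bigr => j _; rewrite card_tag_fiber.
have := jgraph_realizes raK rbK; rewrite -sumA -sumB !card_ord => real.
apply: min_edges_le_realizes real _; apply: leq_trans (jgraph_edges _ _ _ _) _.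
rewrite !card_ord leq_add ?leq_add //; apply: leq_sum => i _;
  by rewrite card_tag_fiber.
Qed.

(* q = a p + b is split as b parts a + 1 and p - b parts a. *)
Lemma sum_split (F : nat -> nat) p a b : b <= p ->
  \sum_(i < p) F (a + (i < b)) = b * F a.+1 + (p - b) * F a.
Proof.
move=> lebp; rewrite -(big_mkord xpredT (fun i => F (a + (i < b)))).
rewrite (big_cat_nat _ lebp) //=; congr (_ + _).
  rewrite (eq_big_nat _ _ (F2 := fun=> F a.+1)) ?sum_nat_const_nat ?subn0 //.
  by move=> i /andP[_ ->]; rewrite addn1.
rewrite (eq_big_nat _ _ (F2 := fun=> F a)) ?sum_nat_const_nat //.
by move=> i /andP[lebi _]; rewrite ltnNge lebi addn0.
Qed.

(** A polynomial form that [nia] can handle. *)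
Lemma bin2_double_add1 a : 'C(2 * a + 1, 2) = a * (2 * a + 1).
Proof. by rewrite addn1 mul2n bin2odd /= ?odd_double // doubleK mulnC. Qed.

(* Subtractions on nat are never truncated under the hypotheses in force;
   p - 2q + r is written p + r - 2 * q for this reason. *)
Theorem theorem3p4 (p q r : nat)
  (hp : 2 <= p) (hpq : p < q) (hqr : q <= r) (hr : r <= 2 * q) :
  [/\ forall a1 b1 : nat,
        q = a1 * p + b1 -> b1 <= p - 1 ->
        min_edges_le p q q ((a1 ^ 2 + 1) * p + (2 * a1 + 1) * b1),
      q < r -> r <= 2 * q - p + 1 ->
        forall a2 b2 : nat,
        2 * q - r = a2 * (p - 1) + b2 -> b2 <= p - 2 ->
        min_edges_le p q r
          (a2 ^ 2 * (p - 1) + (2 * a2 + 1) * b2 + p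
             + 'C(2 * (r - q) + 1, 2))
    & 2 * q - p + 1 < r ->
        forall a3 b3 : nat,
        r - q = a3 * (p + r - 2 * q) + b3 -> b3 <= p + r - 2 * q - 1 ->
        min_edges_le p q r
          (p + (2 * q - r) + (p + r - 2 * q) * 'C(2 * a3 + 1, 2)
             + b3 * (4 * a3 + 3))].

Proof.
have red p1 q1 r1 N1 p2 q2 r2 N2 : min_edges_le p1 q1 r1 N1 ->
    p1 = p2 -> q1 = q2 -> r1 = r2 -> N1 <= N2 -> min_edges_le p2 q2 r2 N2.
  by case=> m Hm leN1 <- <- <- leN; exists m => //; apply: leq_trans leN.
split=> [a b Dq leb|ltqr ler a b Dq leb|ltr a b Dr leb].
(* If [a = 0], then [q = b < p], against [p < q]. So all parts are nonempty. *)
- have a0 : 0 < a by case: a Dq => //; lia.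
  have n0 (i : 'I_p) : 0 < a + (i < b) by rewrite addn_gt0 a0.
  have m0 (j : 'I_0) : 0 < 0 by case: j.
  move: (min_edges_le_sum n0 m0).
  rewrite !big_ord0 (sum_split id) ?(sum_split (expn^~ 2)); [|lia..].
  (* [s] counts the parts of size [a]; it removes the truncated subtraction before [nia]. *)
  have [s Dp] : exists s, p = b + s by exists (p - b); lia.
  move=> /red; apply; rewrite -?mulnn; nia.
(* Here [2 * q - r >= p - 1 > b] forces [a > 0]. *)
- have a0 : 0 < a by case: a Dq => //; lia.
  have n0 (i : 'I_(p - 1)) : 0 < a + (i < b) by rewrite addn_gt0 a0.
  have m0 (j : 'I_1) : 0 < r - q by lia.
  move: (min_edges_le_sum n0 m0).
  rewrite !big_ord1 (sum_split id) ?(sum_split (expn^~ 2)); [|lia..].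
  have [s Dp] : exists s, p - 1 = b + s by exists (p - 1 - b); lia.
  move=> /red; apply; rewrite -?mulnn; nia.
(* If [a = 0], then [r - q = b < p + r - 2 * q], which contradicts [p < q]. *)
have a0 : 0 < a by case: a Dr => //; lia.
have n0 (i : 'I_(2 * q - r)) : 0 < 1 by [].
have m0 (j : 'I_(p + r - 2 * q)) : 0 < a + (j < b) by rewrite addn_gt0 a0.
move: (min_edges_le_sum n0 m0).
rewrite (sum_split id) ?(sum_split (fun m => 'C(2 * m + 1, 2))); [|lia..].
rewrite !sum_nat_const card_ord !bin2_double_add1.
have [s Ds] : exists s, p + r - 2 * q = b + s by exists (p + r - 2 * q - b); lia.
(* Enlarging a part from [a] to [a + 1] costs [(a + 1) * (2a + 3) - a * (2a + 1) = 4a + 3] edges. *)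
move=> /red; apply; nia.
Qed.
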